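(* Let $\mathbf F^k$ be the $k$-dimensional vector space over a finite field $\mathbf F$ (with $k\in\mathbb N$) and let $\mathbf B$ be a finite module whose order is coprime to $|F|$. Then: (1) there are only finitely many clonoids from $\mathbf F^k$ to $\mathbf B$; (2) every clonoid $\mathcal C$ from $\mathbf F^k$ to $\mathbf B$ is finitely related by a relation of arity at most $|F|^{k^2}$, i.e. there are $d\le |F|^{k^2}$ and relations $P\subseteq (F^k)^d$, $Q\subseteq B^d$ such that $\mathcal C=\mathrm{Pol}\big((F^k,P),(B,Q)\big)$.
   Context: $\mathbb N=\{1,2,\dots\}$. Rings are unital, modules are left modules. For sets $A,B$, $\mathcal O_{A,B}=\bigcup_{m\ge 1}B^{A^m}$; for $\mathcal C\subseteq\mathcal O_{A,B}$, $\mathcal C^{(m)}=\mathcal C\cap B^{A^m}$. A module over a ring $\mathbf S$ is viewed as an algebra $(A,+,0,-,(s)_{s\in S})$; its $m$-ary term operations are the maps $\sum_{i=1}^ms_ix_i$ with $s_i\in S$. A clonoid from an algebra $\mathbf A$ to an algebra $\mathbf B$ is a set $\mathcal C\subseteq\mathcal O_{A,B}$ such that for all $m,n\in\mathbb N$: (i) if $f_1,\dots,f_n\in\mathcal C^{(m)}$ and $g$ is an $n$-ary term operation of $\mathbf B$, then $g\circ(f_1,\dots,f_n)\in\mathcal C^{(m)}$; (ii) if $f\in\mathcal C^{(m)}$ and $g_1,\dots,g_m$ are $n$-ary term operations of $\mathbf A$, then $f\circ(g_1,\dots,g_m)\in\mathcal C^{(n)}$. For relational structures $\mathbb A=(A,P)$,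 $\mathbb B=(B,Q)$ with one relation each of the same arity $d$, $\mathrm{Pol}(\mathbb A,\mathbb B)$ is the set of all $f\colon A^m\to B$ ($m\ge1$) such that $f(\mathbf a_1,\dots,\mathbf a_m)\in Q$ (evaluated coordinatewise) for all $\mathbf a_1,\dots,\mathbf a_m\in P$. *)

(* Defs.v *)
From HB Require Import structures.
From mathcomp Require Import all_boot all_order all_algebra.
From mathcomp Require Import boolp classical_sets functions cardinality.

Set Implicit Arguments.
Unset Strict Implicit.
Unset Printing Implicit Defensive.

Import GRing.Theory.

Local Open Scope ring_scope.
Local Open Scope classical_set_scope.

(* The disjoint union of the B^(A^m) over m >= 1; arities are positive, so the
   component of index n holds the operations of arity n.+1. *)
Definition opset (A B : Type) : Type := {n : nat & ('I_n.+1 -> A) -> B}.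

Definition op_part (A B : Type) (C : set (opset A B)) (n : nat) :
    set (('I_n.+1 -> A) -> B) :=
  [set f | C (existT (fun n => ('I_n.+1 -> A) -> B) n f)].
Arguments op_part {A B} C n _.

Definition term_operation (S : pzRingType) (M : lmodType S) (n : nat)
    (g : ('I_n -> M) -> M) : Prop :=
  exists s : 'I_n -> S, g = fun x => \sum_(i < n) s i *: x i.

(* m and n below stand for the arities m.+1 and n.+1. *)
Definition clonoid (R S : pzRingType) (A : lmodType R) (B : lmodType S)
    (C : set (opset A B)) : Prop :=
  (forall (m n : nat) (f : 'I_n.+1 -> (('I_m.+1 -> A) -> B))
      (g : ('I_n.+1 -> B) -> B),
    (forall i, op_part C m (f i)) -> term_operation g ->
    op_part C m (fun x => g (fun i => f i x))) /\
  (forall (m n : nat) (f : ('I_m.+1 -> A) -> B)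
      (g : 'I_m.+1 -> (('I_n.+1 -> A) -> A)),
    op_part C m f -> (forall i, term_operation (g i)) ->
    op_part C n (fun x => f (fun i => g i x))).

Definition Pol (A B : Type) (d : nat) (P : set ('I_d -> A)) (Q : set ('I_d -> B)) :
    set (opset A B) :=
  [set f : opset A B | let: existT n h := f in
    forall a : 'I_n.+1 -> ('I_d -> A),
      (forall i, P (a i)) -> Q (fun j => h (fun i => a i j))].

(* Main.v *)
Require Import Defs.
From HB Require Import structures.
From mathcomp Require Import all_boot all_order all_algebra.
From mathcomp Require Import boolp classical_sets functions cardinality.

(* Let q = |F|, which is invertible on B. The clonoid C is determined by its
   k-ary part because every f : (F^k)^n -> B is a Z-linear combination of its
   minors x |-> f (x M) with \rank M <= k. This follows from the fact (Kovacs)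
   that, with q inverted, the matrices of rank at most r span an ideal with an
   identity element in the monoid ring of n x n matrices over F. By induction on
   r, let e0 be the identity for rank < r in size n, and let v = 1 - e be the
   element in size r that kills all singular matrices. Up to a power of q,
   the sum over the L of v(A L) [L A], for A of full rank r, acts as v inside
   the row space of A and annihilates every other X with \rank X <= r.
   Summing over the r-dimensional row spaces gives s with
   e0 + s (1 - e0) the identity for rank < r + 1. Hence C = Pol(P, Q), where P
   is the k-ary term operations and Q the k-ary part of C, both read as tuples
   indexed by the k x k matrices. *)

Set Implicit Arguments.
Unset Strict Implicit.
Unset Printing Implicit Defensive.

Import GRing.Theory.

Local Open Scope ring_scope.
Local Open Scope classical_set_scope.

(** * Fibres of left multiplication by a matrix of full row rank *)

Lemma card_fiber_mulmx (F : finFieldType) (r n p : nat) (A : 'M[F]_(r, n))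
    (N : 'M[F]_(r, p)) : row_free A ->
  #|[pred L : 'M[F]_(n, p) | A *m L == N]| =
  #|[pred L : 'M[F]_(n, p) | A *m L == 0]|.
Proof.
move=> /mulmxVp AV.
rewrite -!sum1_card (reindex_inj (addIr (pinvmx A *m N))) /=.
by apply: eq_bigl => L; rewrite !inE mulmxDr mulmxA AV mul1mx -subr_eq0 addrK.
Qed.

Lemma sum_mulmx_row_free (F : finFieldType) (V : zmodType) (r n p : nat)
    (A : 'M[F]_(r, n)) (h : 'M[F]_(r, p) -> V) : row_free A ->
  \sum_(L : 'M[F]_(n, p)) h (A *m L) =
  (\sum_N h N) *+ #|[pred L : 'M[F]_(n, p) | A *m L == 0]|.
Proof.
move=> fA; rewrite (partition_big (fun L => A *m L) predT) //= -sumrMnl.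
apply: eq_bigr => N _; rewrite -(card_fiber_mulmx N fA) -sumr_const.
by apply: eq_big => // L /eqP ->.
Qed.

(** All fibres of [L |-> A *m L] have the size of the kernel. The divisibility makes that size
    invertible on [V] once [#|F|] is. *)
Lemma card_ker_mulmx_dvd (F : finFieldType) (r n p : nat) (A : 'M[F]_(r, n)) :
  row_free A ->
  (#|[pred L : 'M[F]_(n, p) | A *m L == 0%R]| %| #|F| ^ (n * p))%N.
Proof.
move=> fA; rewrite -card_mx -[X in (_ %| X)%N]sum1_card.
rewrite [X in (_ %| X)%N](partition_big (fun L => A *m L) predT) //=.
rewrite (eq_bigr (fun=> #|[pred L : 'M[F]_(n, p) | A *m L == 0]|)) => [|N _].
  by rewrite sum_nat_const dvdn_mull.
by rewrite -(card_fiber_mulmx N fA) -sum1_card; apply: eq_bigl.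
Qed.

Lemma dvd_expn_mulrn_inv (V : zmodType) (q t e s : nat) :
  (forall x : V, x *+ (q * t) = x) -> (s %| q ^ e)%N ->
  exists s', forall x : V, x *+ s *+ s' = x.
Proof.
move=> qt /dvdnP[u qe]; exists (u * t ^ e)%N => x.
rewrite -mulrnA mulnA [(s * u)%N]mulnC -qe -expnMn.
by elim: e {qe} => [|e IH]; rewrite ?mulr1n // expnSr mulrnA IH qt.
Qed.

(* Averaging over the [L0] with [A *m L0 = 0] makes the summand depend on
   [X *m L] only through [kappa *m X *m L], where [kappa] is a projection whose
   image is mapped by [X] into the row space of [A]; there the rank drops. *)
Lemma sum_row_free_not_sub (F : finFieldType) (V : zmodType) (t : nat)
    (qt : forall x : V, x *+ (#|F| * t) = x) (r n j : nat) (v : 'M[F]_r -> int)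
    (v_kill : forall (h : 'M[F]_(j, r) -> V) (y : 'M[F]_(j, r)),
       (\rank y < r)%N -> \sum_N h (y *m N) *~ v N = 0)
    (A : 'M[F]_(r, n)) (X : 'M[F]_(j, n)) (phi : 'M[F]_(j, r) -> V) :
  row_free A -> (\rank X <= r)%N -> ~~ (X <= A)%MS ->
  \sum_(L : 'M[F]_(n, r)) phi (X *m L) *~ v (A *m L) = 0.
Proof.
move=> fA rX nXA.
set Q := cokermx A; set H := Q *m pinvmx (X *m Q); set kappa := 1%:M - X *m H.
have AH : A *m H = 0 by rewrite mulmxA mulmx_coker mul0mx.
have kXA : (kappa *m X <= A)%MS.
  rewrite submxE -/Q -mulmxA mulmxBl mul1mx /H [X *m (Q *m _)]mulmxA.
  by rewrite mulmxKpV ?subrr.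
have [z zE] := submxP kXA.
have rz : (\rank z < r)%N.
  (* The rank drops strictly: otherwise [X] would lie in the row space of [kappa *m X], hence in
     that of [A]. *)
  rewrite -(mxrankMfree z fA) -zE; apply: leq_trans rX.
  rewrite (ltn_leqif (mxrank_leqif_sup (submxMl kappa X))).
  by apply: contra nXA => /submx_trans; apply.
pose psi y := \sum_(L0 : 'M[F]_(n, r) | A *m L0 == 0) phi (y + X *m L0).
have psiE y : psi y = psi (kappa *m y).
  (* Translate [L0] by [H *m y], which [A] kills, and use [y = kappa *m y + X *m H *m y]. *)
  rewrite /psi [RHS](reindex_inj (addIr (H *m y))) /=.
  apply: eq_big => [L0|L0 _]; first by rewrite mulmxDr mulmxA AH mul0mx addr0.
  rewrite mulmxDr /kappa mulmxBl mul1mx -!mulmxA; congr phi.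
  by rewrite -addrA; congr (_ + _); rewrite addrCA addNr addr0.
have [s' ss'] := dvd_expn_mulrn_inv qt (card_ker_mulmx_dvd r fA).
rewrite -[LHS]ss'; set s := #|_|.
suff -> : (\sum_(L : 'M[F]_(n, r)) phi (X *m L) *~ v (A *m L)) *+ s = 0.
  by rewrite mul0rn.
rewrite /s -sumr_const.
transitivity (\sum_(L : 'M[F]_(n, r)) psi (X *m L) *~ v (A *m L)).
  under [RHS]eq_bigr do rewrite mulrz_suml.
  rewrite [RHS]exchange_big /=; apply: eq_bigr => L0 /eqP AL0.
  rewrite (reindex_inj (addIr L0)) /=; apply: eq_bigr => L _.
  by rewrite !mulmxDr AL0 addr0.
under eq_bigr do rewrite psiE mulmxA zE -mulmxA.
rewrite (sum_mulmx_row_free (fun N => psi (z *m N) *~ v N) fA).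
by rewrite v_kill ?mul0rn.
Qed.

(** * Identities for matrices of bounded rank *)

(** The action of a monoid ring element supported in rank below [r]. As [c] is uniform in [j], [f]
    and [X], such operators compose without constructing the ring. *)
Definition rank_comb (F : finFieldType) (V : zmodType) (n r : nat)
    (T : forall j, ('M[F]_(j, n) -> V) -> 'M[F]_(j, n) -> V) : Prop :=
  exists c : 'M[F]_n -> int, forall j (f : 'M[F]_(j, n) -> V) X,
    T j f X = \sum_(M : 'M[F]_n | (\rank M < r)%N) f (X *m M) *~ c M.

Lemma rank_comb_mulmx (F : finFieldType) (V : zmodType) (n r : nat)
    (M : 'M[F]_n) (z : int) : (\rank M < r)%N ->
  @rank_comb F V n r (fun j f X => f (X *m M) *~ z).
Proof.
move=> rM; exists (fun N => if N == M then z else 0) => j f X.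
rewrite (bigD1 M) //= eqxx big1 ?addr0 // => N /andP[_ /negbTE ->].
by rewrite mulr0z.
Qed.

Lemma rank_comb_sum (F : finFieldType) (V : zmodType) (n r : nat)
    (I : finType) (P : pred I)
    (T : I -> forall j, ('M[F]_(j, n) -> V) -> 'M[F]_(j, n) -> V) :
  (forall i, P i -> rank_comb r (T i)) ->
  rank_comb r (fun j f X => \sum_(i | P i) T i j f X).
Proof.
move=> TP.
have /choice[c cP] : forall i, exists c : 'M[F]_n -> int, P i ->
    forall j (f : 'M[F]_(j, n) -> V) X,
    T i j f X = \sum_(M : 'M[F]_n | (\rank M < r)%N) f (X *m M) *~ c M.
  move=> i; have [Pi|] := boolP (P i); last by exists (fun=> 0).
  by have [c] := TP i Pi; exists c.
exists (fun M => \sum_(i | P i) c i M) => j f X.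
under [RHS]eq_bigr do rewrite mulrz_sumr.
by rewrite exchange_big /=; apply: eq_bigr => i Pi; rewrite cP.
Qed.

Lemma rank_combD (F : finFieldType) (V : zmodType) (n r : nat)
    (T T' : forall j, ('M[F]_(j, n) -> V) -> 'M[F]_(j, n) -> V) :
  rank_comb r T -> rank_comb r T' ->
  rank_comb r (fun j f X => T j f X + T' j f X).
Proof.
move=> [c cP] [c' c'P]; exists (fun M => c M + c' M) => j f X.
by rewrite cP c'P -big_split; apply: eq_bigr => M _; rewrite mulrzDr.
Qed.

Lemma rank_combMz (F : finFieldType) (V : zmodType) (n r : nat) (z : int)
    (T : forall j, ('M[F]_(j, n) -> V) -> 'M[F]_(j, n) -> V) :
  rank_comb r T -> rank_comb r (fun j f X => T j f X *~ z).
Proof.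
move=> [c cP]; exists (fun M => c M * z) => j f X.
by rewrite cP mulrz_suml; apply: eq_bigr => M _; rewrite mulrzA.
Qed.

(** With [e] the sum of the [c M [M]], this is [[X] e = [X]], tested on functions into [V]. *)
Definition rank_identity (F : finFieldType) (V : zmodType) (n r : nat) : Prop :=
  exists c : 'M[F]_n -> int, forall j (f : 'M[F]_(j, n) -> V) X,
    (\rank X < r)%N ->
    \sum_(M : 'M[F]_n | (\rank M < r)%N) f (X *m M) *~ c M = f X.

Lemma rank_identityS (F : finFieldType) (V : zmodType) (t : nat) (n r : nat) :
  (forall x : V, x *+ (#|F| * t) = x) ->
  rank_identity F V n r -> rank_identity F V r r -> rank_identity F V n r.+1.
Proof.
move=> qt [c0 c0P] [c cP].
(* The coefficients of [1 - e], truncated because [c] is unconstrained at rank [r]. *)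
pose v (N : 'M[F]_r) : int :=
  (N == 1%:M)%:R - (if (\rank N < r)%N then c N else 0).
have vE j (h : 'M[F]_(j, r) -> V) (y : 'M[F]_(j, r)) :
    \sum_N h (y *m N) *~ v N =
    h y - \sum_(N | (\rank N < r)%N) h (y *m N) *~ c N.
  rewrite [in RHS]big_mkcond /=.
  under eq_bigr do rewrite mulrzBr.
  rewrite sumrB; congr (_ - _).
    rewrite (bigD1 1%:M) //= eqxx mulmx1 big1 ?addr0 // => N /negbTE ->.
    by rewrite mulr0z.
  by apply: eq_bigr => N _; case: ifP => // _; rewrite mulr0z.
have v_kill j (h : 'M[F]_(j, r) -> V) (y : 'M[F]_(j, r)) :
    (\rank y < r)%N -> \sum_N h (y *m N) *~ v N = 0.
  by move=> ry; rewrite vE cP ?subrr.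
pose rep (A : 'M[F]_(r, n)) := choose (fun A' : 'M[F]_(r, n) => (A' == A)%MS) A.
have repE (A : 'M[F]_(r, n)) : (rep A :=: A)%MS.
  by apply/eqmxP; apply: (chooseP (P := fun A' => (A' == A)%MS)); apply/eqmxP.
have rep_eqmx (A A' : 'M[F]_(r, n)) : (A == A')%MS -> rep A = rep A'.
  move=> AA'; rewrite /rep.
  rewrite (@eq_choose _ _ (fun A1 : 'M[F]_(r, n) => (A1 == A')%MS)) => [|A1].
    by apply: choose_id => //; apply/eqmxP.
  by rewrite !(eqmxP AA').
have inv_ex (A : 'M[F]_(r, n)) : exists s' : nat, row_free A -> forall x : V,
    x *+ #|[pred L : 'M[F]_(n, r) | A *m L == 0]| *+ s' = x.
  have [fA|_] := boolP (row_free A); last by exists 0.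
  by have [s' ?] := dvd_expn_mulrn_inv qt (card_ker_mulmx_dvd r fA); exists s'.
have [s' s'P] := choice inv_ex.
(* The condition [rep A == A] keeps one [A] per [r]-dimensional row space; [s' A] cancels the fibre
   size of [L |-> A *m L]. *)
pose S j (f : 'M[F]_(j, n) -> V) X :=
  \sum_(A : 'M[F]_(r, n) | row_free A && (rep A == A))
    \sum_(L : 'M[F]_(n, r)) f (X *m (L *m A)) *~ (v (A *m L) * (s' A)%:Z).
have S_term j (f : 'M[F]_(j, n) -> V) (A : 'M[F]_(r, n)) X :
    row_free A -> (\rank X <= r)%N ->
    \sum_(L : 'M[F]_(n, r)) f (X *m (L *m A)) *~ (v (A *m L) * (s' A)%:Z) =
    if (X <= A)%MS then \sum_N f (X *m pinvmx A *m N *m A) *~ v N else 0.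
  move=> fA rX.
  under eq_bigr do rewrite mulrzA.
  rewrite -mulrz_suml -pmulrn; case: ifPn => XA.
    have XE (L : 'M[F]_(n, r)) :
        X *m (L *m A) = X *m pinvmx A *m (A *m L) *m A.
      by rewrite mulmxA [_ *m (A *m L)]mulmxA mulmxKpV.
    under eq_bigr do rewrite XE.
    rewrite (sum_mulmx_row_free (fun N => f (X *m pinvmx A *m N *m A) *~ v N) fA).
    exact: s'P.
  under eq_bigr do rewrite mulmxA.
  by rewrite (sum_row_free_not_sub qt (v_kill j) (fun y => f (y *m A)) fA rX XA)
    mul0rn.
(* At rank [r] only the representative of the row space of [X] contributes: [v] gives [g X] minus
   values of [g] at smaller rank, which are 0. *)
have S_fix j (g : 'M[F]_(j, n) -> V) :
    (forall X, (\rank X < r)%N -> g X = 0) ->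
    forall X, (\rank X <= r)%N -> S j g X = g X.
  move=> g0 X rX; rewrite /S.
  under eq_bigr => A /andP[fA _] do rewrite S_term //.
  have [rX'|rX'] := ltnP (\rank X) r.
    rewrite g0 // big1 // => A /andP[fA _]; case: ifP => // XA.
    apply: (v_kill j (fun y => g (y *m A))).
    by rewrite -(mxrankMfree _ fA) mulmxKpV.
  have rXE : \rank X = r by apply/eqP; rewrite eqn_leq rX.
  pose A0 := castmx (rXE, erefl n) (row_base X).
  have A0X : (A0 :=: X)%MS := eqmx_trans (eqmx_cast _ _) (eq_row_base X).
  have fA1 : row_free (rep A0) by rewrite /row_free (repE A0) A0X rXE.
  have XA1 : (X <= rep A0)%MS by rewrite (repE A0) A0X.
  rewrite (bigD1 (rep A0)) /=; last first.
    by rewrite fA1 (rep_eqmx (rep A0) A0) //=; apply/eqmxP.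
  rewrite XA1 (vE j (fun y => g (y *m rep A0))) mulmxKpV //.
  rewrite big1 ?subr0 => [|N rN]; last first.
    rewrite g0 ?mul0rz // -mulmxA.
    exact/(leq_ltn_trans (mxrankM_maxr _ _))/(leq_ltn_trans (mxrankM_maxl _ _)).
  rewrite big1 ?addr0 // => A /andP[/andP[fA /eqP repA] nA]; case: ifP => // XA.
  case/eqP: nA; rewrite -repA; apply: rep_eqmx.
  have /leqifP := mxrank_leqif_eq XA; rewrite rXE (eqP fA).
  case: ifP => [/eqmxP XA'|_]; last by rewrite ltnn.
  by move=> _; apply/eqmxP/(eqmx_trans (eqmx_sym XA'))/eqmx_sym.
pose e0 j (f : 'M[F]_(j, n) -> V) X :=
  \sum_(M : 'M[F]_n | (\rank M < r)%N) f (X *m M) *~ c0 M.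
have rank_e0 : rank_comb r.+1 e0.
  by apply: rank_comb_sum => M rM; apply: rank_comb_mulmx; apply: ltnW.
have rank_LA (L : 'M[F]_(n, r)) (A : 'M[F]_(r, n)) : (\rank (L *m A) < r.+1)%N.
  by rewrite ltnS (leq_trans (mxrankM_maxl _ _)) ?rank_leq_col.
have rank_S : rank_comb r.+1 S.
  by do 2![apply: rank_comb_sum => ? _]; apply: rank_comb_mulmx.
have rank_Se0 : rank_comb r.+1 (fun j f X => S j (e0 j f) X).
  apply: rank_comb_sum => A _; apply: rank_comb_sum => L _.
  apply: rank_combMz; apply: rank_comb_sum => M _.
  have rLAM : (\rank (L *m A *m M) < r.+1)%N.
    exact: leq_ltn_trans (mxrankM_maxl _ _) (rank_LA L A).
  have [c' c'P] := @rank_comb_mulmx F V n r.+1 _ (c0 M) rLAM.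
  by exists c' => j f X; rewrite -c'P !mulmxA.
(* The element [e0 + S (1 - e0)]: [S] acts on [f - e0 f], which vanishes below rank [r], as [S_fix]
   requires. *)
have [c' c'P] := rank_combD rank_e0 (rank_combD rank_S (rank_combMz (-1) rank_Se0)).
exists c' => j f X; rewrite ltnS => rX; rewrite -c'P mulrN1z.
have -> : S j f X - S j (e0 j f) X = S j (fun Y => f Y - e0 j f Y) X.
  rewrite /S -sumrB; apply: eq_bigr => A _; rewrite -sumrB.
  by apply: eq_bigr => L _; rewrite mulrzBl.
rewrite S_fix => [|Y rY|//]; first by rewrite addrC subrK.
by rewrite [e0 j f Y]c0P // subrr.
Qed.

(** The induction keeps [n] general, since its step uses the identity for rank below [r] in both
    sizes [n] and [r]. *)
Lemma rank_identity_exists (F : finFieldType) (V : zmodType) (t : nat) :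
  (forall x : V, x *+ (#|F| * t) = x) -> forall n r, rank_identity F V n r.
Proof.
move=> qt n r; elim: r n => [|r IH] n; first by exists (fun=> 0).
exact: rank_identityS qt (IH n) (IH r).
Qed.

(** * Inverting an integer coprime to the order of a finite group *)

Lemma card_eq_ordinal_bij (T : Type) (b : nat) :
  ([set: T] #= `I_b)%card -> exists e : 'I_b -> T, bijective e.
Proof.
case/card_set_bijP => f [f_lt f_inj f_surj].
have /choice[e eP] : forall i : 'I_b, exists x, f x = i.
  by move=> i; have [x _ fx] := f_surj i (ltn_ord i); exists x.
exists e, (fun x => Ordinal (f_lt x I)) => [i|x]; first exact/val_inj/eP.
by apply: f_inj; rewrite ?in_setT // eP.
Qed.

(** Translation by [x] permutes the group, so adding [b] copies of [x] preserves the sum of all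
    elements. *)
Lemma card_zmod_torsion (V : zmodType) (b : nat) :
  ([set: V] #= `I_b)%card -> forall x : V, x *+ b = 0.
Proof.
case/card_eq_ordinal_bij => e [e' eK e'K] x.
have h_inj : injective (fun i => e' (e i + x)).
  by move=> i j /(can_inj e'K) /addIr /(can_inj eK).
have := reindex_inj (op := +%R) (x := 0) (P := predT) (F := e) h_inj.
under [RHS]eq_bigr do rewrite e'K.
rewrite big_split /= sumr_const card_ord => e_sum.
by apply: (addrI (\sum_i e i)); rewrite addr0 -e_sum.
Qed.

Lemma coprime_mulrn_inv (V : zmodType) (b q : nat) : (0 < q)%N ->
  coprime b q -> (forall x : V, x *+ b = 0) ->
  exists t, forall x : V, x *+ (q * t) = x.
Proof.
move=> q0 bq Vb; case: (egcdnP b q0) => km kn E _; exists km => x.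
rewrite mulnC E gcdnC (eqP bq) mulrnDr mulnC mulrnA Vb mul0rn.
by rewrite add0r.
Qed.

(** * Clonoids and matrix substitutions *)

(* The [i]-th argument of an operation is stored as the [i]-th column, so that
   substituting linear terms is right multiplication by a matrix. *)
Definition mx_args (F : fieldType) (k n : nat) (X : 'M[F]_(k, n)) :
  'I_n -> 'rV[F]_k := fun i => (col i X)^T.

Definition args_mx (F : fieldType) (k n : nat) (x : 'I_n -> 'rV[F]_k) :
  'M[F]_(k, n) := \matrix_(i, j) x j 0 i.

Lemma args_mxK (F : fieldType) (k n : nat) (x : 'I_n -> 'rV[F]_k) :
  mx_args (args_mx x) = x.
Proof. by apply/funext => i; apply/rowP => j; rewrite !mxE. Qed.

Lemma mx_argsK (F : fieldType) (k n : nat) (X : 'M[F]_(k, n)) :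
  args_mx (mx_args X) = X.
Proof. by apply/matrixP => i j; rewrite !mxE. Qed.

Lemma mx_argsM (F : fieldType) (k m n : nat) (X : 'M[F]_(k, m))
    (M : 'M[F]_(m, n)) (i : 'I_n) :
  mx_args (X *m M) i = \sum_j M j i *: mx_args X j.
Proof.
apply/rowP => l; rewrite summxE !mxE.
by apply: eq_bigr => j _; rewrite !mxE mulrC.
Qed.

Lemma term_operation_mx_args (F : fieldType) (k m n : nat) (M : 'M[F]_(m, n))
    (i : 'I_n) :
  term_operation (fun x : 'I_m -> 'rV[F]_k => mx_args (args_mx x *m M) i).
Proof.
by exists (M^~ i); apply/funext => x; rewrite mx_argsM args_mxK.
Qed.

Lemma rank_leq_factor (F : fieldType) (m n k : nat) (M : 'M[F]_(m, n)) :
  (\rank M <= k)%N ->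
  exists (M1 : 'M[F]_(m, k)) (M2 : 'M[F]_(k, n)), M = M1 *m M2.
Proof.
move=> rM; exists (col_ebase M *m pid_mx (\rank M)).
exists (pid_mx (\rank M) *m row_ebase M).
rewrite mulmxA -[col_ebase M *m _ *m _]mulmxA mul_pid_mx minnn.
by rewrite (minn_idPr rM) mulmx_ebase.
Qed.

Lemma clonoid_mulmx (F : finFieldType) (k : nat) (S : pzRingType)
    (B : lmodType S) (C : set (opset 'rV[F]_k B)) (m n : nat)
    (f : ('I_m.+1 -> 'rV[F]_k) -> B) (M : 'M[F]_(n.+1, m.+1)) :
  clonoid C -> op_part C m f ->
  op_part C n (fun x => f (mx_args (args_mx x *m M))).
Proof.
case=> _ CA Cf.
by apply: (CA m n f _ Cf) => i; apply: term_operation_mx_args.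
Qed.

(** The index [i0] makes the sum nonempty, as clonoids are closed under term operations of positive
    arity. *)
Lemma clonoid_comb (F : finFieldType) (k : nat) (S : pzRingType)
    (B : lmodType S) (C : set (opset 'rV[F]_k B)) (m : nat) (I : finType)
    (P : pred I) (f : I -> ('I_m.+1 -> 'rV[F]_k) -> B) (c : I -> int) (i0 : I) :
  clonoid C -> P i0 -> (forall i, P i -> op_part C m (f i)) ->
  op_part C m (fun x => \sum_(i | P i) f i x *~ c i).
Proof.
case=> CB _ Pi0 Cf.
have comb_ord N (g : 'I_N -> I) : (0 < N)%N -> (forall i, P (g i)) ->
    op_part C m (fun x => \sum_i f (g i) x *~ c (g i)).
  case: N g => // N g _ Pg.
  have := CB m N (fun i => f (g i)) (fun y => \sum_i (c (g i))%:~R *: y i)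
    (fun i => Cf _ (Pg i)) (ex_intro _ _ erefl).
  by under [X in op_part C m X -> _]funext do under eq_bigr do rewrite scaler_int.
have -> : (fun x => \sum_(i | P i) f i x *~ c i) =
    fun x => \sum_(i < #|P|) f (enum_val i) x *~ c (enum_val i).
  apply/funext => x.
  exact: (@big_enum_val _ _ _ _ (mem P) (fun i => f i x *~ c i)).
by apply: comb_ord => [|i]; [apply/card_gt0P; exists i0|apply: (enum_valP i)].
Qed.

(* A [k]-ary operation evaluated at all of ['M[F]_k] is a tuple of length
   [#|F| ^ (k ^ 2)]; [term_tuples] are the tuples of the term operations and
   [op_tuples C] those of the [k]-ary part of [C]. *)
Definition term_tuples (F : finFieldType) (k : nat) :
    set ('I_#|{: 'M[F]_k}| -> 'rV[F]_k) :=
  [set p | exists s : 'cV[F]_k, p = fun j => (enum_val j *m s)^T].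

Definition op_tuples (F : finFieldType) (k : nat) (B : Type)
    (C : set (opset 'rV[F]_k.+1 B)) : set ('I_#|{: 'M[F]_k.+1}| -> B) :=
  [set q | exists2 h, op_part C k h & q = fun j => h (mx_args (enum_val j))].

Lemma clonoid_eq_Pol (F : finFieldType) (k : nat) (S : pzRingType)
    (B : lmodType S) (t : nat) (C : set (opset 'rV[F]_k.+1 B)) :
  (forall x : B, x *+ (#|F| * t) = x) -> clonoid C ->
  C = Pol (@term_tuples F k.+1) (op_tuples C).
Proof.
move=> qt Ccl; apply/seteqP; split=> -[m f] /=.
  move=> Cf a /choice[s aE].
  pose M : 'M[F]_(k.+1, m.+1) := \matrix_(i, j) s j i 0.
  exists (fun x => f (mx_args (args_mx x *m M))).
    exact: (@clonoid_mulmx F k.+1 S B C m k f M Ccl Cf).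
  apply/funext => j; congr f; apply/funext => i; rewrite aE mx_argsK.
  by apply/rowP => l; rewrite !mxE; apply: eq_bigr => l' _; rewrite !mxE.
move=> fPol.
have minor (M : 'M[F]_(k.+1, m.+1)) :
    op_part C k (fun x => f (mx_args (args_mx x *m M))).
  (* The columns of [M] serve as coefficient vectors of terms; as [j] runs over all square matrices,
     the tuple records every value of the minor. *)
  have [i|h Ch hE] := fPol (fun i j => (enum_val j *m col i M)^T).
    by exists (col i M).
  suff -> : (fun x => f (mx_args (args_mx x *m M))) = h by [].
  apply/funext => x; have := congr1 (fun q => q (enum_rank (args_mx x))) hE.
  rewrite /= enum_rankK args_mxK => <-; congr f; apply/funext => i.
  by apply/rowP => l; rewrite !mxE; apply: eq_bigr => l' _; rewrite !mxE.
(* Rank below [k.+2] is rank at most the dimension [k.+1], the number of rows of every argument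
   matrix. *)
have [c cP] := rank_identity_exists qt m.+1 k.+2.
suff -> : f = fun x => \sum_(M : 'M[F]_m.+1 | (\rank M < k.+2)%N)
    f (mx_args (args_mx x *m M)) *~ c M.
  apply: (clonoid_comb (i0 := 0) _ Ccl); first by rewrite mxrank0.
  (* The minor by [M] is thus the minor by [M1] of a [k.+1]-ary minor already in [C]. *)
  move=> M; rewrite ltnS => /rank_leq_factor[M1 [M2 ->]].
  have := clonoid_mulmx (n := m) M1 Ccl (minor M2).
  by under [X in op_part C m X -> _]funext do rewrite mx_argsK -mulmxA.
apply/funext => x; rewrite (cP k.+1 (fun X => f (mx_args X))) ?args_mxK //.
by rewrite ltnS rank_leq_row.
Qed.

Lemma finite_set_sets (T : Type) (n : nat) (d : nat) :
  ([set: T] #= `I_n)%card -> finite_set [set: set ('I_d -> T)].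
Proof.
case/card_eq_ordinal_bij => e [e' eK e'K].
pose G (X : {set {ffun 'I_d -> 'I_n}}) :=
  [set q : 'I_d -> T | [ffun i => e' (q i)] \in X].
have GT := finite_image G (finite_finset (X := setT)).
apply: sub_finite_set GT => Q _.
exists [set p : {ffun 'I_d -> 'I_n} | `[< Q (fun i => e (p i)) >]]%SET => //.
have qE (q : 'I_d -> T) : (fun i => e ([ffun i => e' (q i)] i)) = q.
  by apply/funext => i; rewrite ffunE e'K.
by apply/seteqP; split=> q; rewrite /G /= inE => /asboolP; rewrite qE.
Qed.

Theorem corollary51 (F : finFieldType) (k : nat) (hk : (0 < k)%N)
    (S : pzRingType) (B : lmodType S) (b : nat)
    (hB : ([set: B] #= `I_b)%card) (hcop : coprime b #|F|) :
  finite_set [set C : set (opset 'rV[F]_k B) | clonoid C] /\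
  (forall C : set (opset 'rV[F]_k B), clonoid C ->
    exists (d : nat) (P : set ('I_d -> 'rV[F]_k)) (Q : set ('I_d -> B)),
      (0 < d <= #|F| ^ (k ^ 2))%N /\ C = Pol P Q).
Proof.
case: k hk => // k _.
have F_gt0 : (0 < #|F|)%N by apply/card_gt0P; exists 0.
have [t qt] := coprime_mulrn_inv F_gt0 hcop (card_zmod_torsion hB).
split.
  (* The left relation is common to all clonoids, so the right one, of which there are finitely
     many, determines the clonoid. *)
  have fin := finite_image (Pol (@term_tuples F k.+1)) (finite_set_sets _ hB).
  apply: sub_finite_set fin => C Ccl; exists (op_tuples C) => //.
  exact/esym/(clonoid_eq_Pol qt).
move=> C Ccl; exists #|{: 'M[F]_k.+1}|, (@term_tuples F k.+1), (op_tuples C).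
split; last exact: clonoid_eq_Pol qt Ccl.
by rewrite card_mx expn_gt0 F_gt0 mulnn leqnn.
Qed.
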